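(* Let $q,n\in\mathbb{N}$ and let $M$ be an $n\times n$ integer matrix satisfying $M\mathbf{1}_n=M^T\mathbf{1}_n$, where $\mathbf{1}_n$ is the all-one vector of length $n$. Then there exists a $q$-dimensional $M$-crystal, i.e., a function $C:[n]^q\to\mathbb{Z}$ such that for every pair $1\le i_1<i_2\le q$ and all $a,b\in[n]$, $$\sum_{\mathbf{c}\in[n]^q,\ c_{i_1}=a,\ c_{i_2}=b} C(\mathbf{c}) = M_{a,b}.$$
   Context: $[n]=\{1,\dots,n\}$; tuples $\mathbf{c}=(c_1,\dots,c_q)\in[n]^q$. (In the paper's notation, a $q$-dimensional $M$-crystal is $C\in\mathcal{T}^{n\cdot\mathbf{1}_q}(\mathbb{Z})$ with $\Pi^{n\cdot\mathbf 1_q}_{\mathbf{i}}\ast C=M$ for every increasing pair $\mathbf{i}=(i_1,i_2)\in[q]^2$, which is exactly the displayed marginal condition.) *)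

(* Defs.v *)
From mathcomp Require Import all_boot all_order all_algebra.

Set Implicit Arguments.
Unset Strict Implicit.
Unset Printing Implicit Defensive.

Import GRing.Theory.
Local Open Scope ring_scope.

(* The index set [n] = {1, ..., n} is rendered as 'I_n = {0, ..., n-1}, and a
   tuple in [n]^q as a finite function 'I_q -> 'I_n. *)
Definition is_crystal (q n : nat) (M : 'M[int]_n)
    (C : {ffun 'I_q -> 'I_n} -> int) : Prop :=
  forall i1 i2 : 'I_q, (i1 < i2)%N -> forall a b : 'I_n,
    \sum_(c : {ffun 'I_q -> 'I_n} | (c i1 == a) && (c i2 == b)) C c = M a b.

(* Main.v *)
Require Import Defs.
From mathcomp Require Import all_boot all_order all_algebra.
From mathcomp Require Import ring.

Set Implicit Arguments.
Unset Strict Implicit.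
Unset Printing Implicit Defensive.

Import GRing.Theory.
Local Open Scope ring_scope.

(** Fix a base point 0 in [n], write d for the point mass at 0 and e_a for the
    point mass at a minus d, so that e_a has total mass 0. Expanding
    (e_a + d) (x) (e_b + d) splits M into a part in e_a (x) e_b, parts in
    e_a (x) d and d (x) e_b, whose coefficients are the row and column sums of
    M, and a part in d (x) d. Placing the first part at every increasing pair
    of coordinates, the second at every single coordinate (where equality of
    the row and column sums is needed), and filling the other coordinates
    with d, gives a crystal: in the marginal at (i1, i2), each term with an e
    outside {i1, i2} vanishes. *)

(** The two constraints bear on separate coordinates, so the admissible [c] form a product set, the
    family [Q], and distributivity applies; the sums at [i1] and [i2] collapse to one term. *)
Lemma sum_prod_fix2 (R : comNzRingType) (I T : finType) (i1 i2 : I) (x y : T)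
    (f : I -> T -> R) : i1 != i2 ->
  \sum_(c : {ffun I -> T} | (c i1 == x) && (c i2 == y)) \prod_k f k (c k) =
  f i1 x * f i2 y * \prod_(k | (k != i1) && (k != i2)) \sum_t f k t.
Proof.
move=> ne12; have ne21 : i2 != i1 by rewrite eq_sym.
pose Q k := [pred t | ((k == i1) ==> (t == x)) && ((k == i2) ==> (t == y))].
transitivity (\sum_(c in family Q) \prod_k f k (c k)).
  apply: eq_bigl => c; apply/andP/familyP => [[/eqP c1 /eqP c2] k | cQ].
    by rewrite inE; apply/andP; split; apply/implyP => /eqP->; apply/eqP.
  move: (cQ i1) (cQ i2); rewrite !inE !eqxx /=.
  by move=> /andP[-> _] /andP[_ ->].
rewrite -bigA_distr_big_dep (bigD1 i1) //= (bigD1 i2) ?ne21 //= mulrA.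
congr (_ * _ * _).
- by rewrite (big_pred1 x) // => t; rewrite /= eqxx (negPf ne12) andbT.
- by rewrite (big_pred1 y) // => t; rewrite /= eqxx (negPf ne21).
- apply: eq_bigr => k /andP[/negPf k1 /negPf k2].
  by apply: eq_bigl => t; rewrite k1 k2.
Qed.

Section Crystal.
Variables (q m : nat).
Implicit Types (v : 'I_q -> option 'I_m.+1) (c : {ffun 'I_q -> 'I_m.+1}).

(* [Some a] encodes e_a and [None] encodes d. *)
Definition factor (o : option 'I_m.+1) (x : 'I_m.+1) : int :=
  if o is Some a then (x == a)%:R - (x == ord0)%:R else (x == ord0)%:R.

Definition pure v c : int := \prod_k factor (v k) (c k).

Definition vec1 (i : 'I_q) (a : 'I_m.+1) (k : 'I_q) :=
  if k == i then Some a else None.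

Definition vec2 (i j : 'I_q) (a b : 'I_m.+1) (k : 'I_q) :=
  if k == i then Some a else if k == j then Some b else None.

Lemma sum_indicator (a : 'I_m.+1) : \sum_x (x == a)%:R = 1 :> int.
Proof.
by rewrite (bigD1 a) //= eqxx big1 ?addr0 // => x /negPf->.
Qed.

Lemma sum_factor o : \sum_x factor o x = (o == None)%:R.
Proof.
by case: o => [a|] /=; rewrite ?sumrB !sum_indicator ?subrr.
Qed.

Section Marginal.
Variables (i1 i2 : 'I_q) (x y : 'I_m.+1).
Hypothesis lt12 : (i1 < i2)%N.

Definition marginal (C : {ffun 'I_q -> 'I_m.+1} -> int) : int :=
  \sum_(c : {ffun _ -> _} | (c i1 == x) && (c i2 == y)) C c.

Lemma marginal_sum (I : finType) (P : pred I) F :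
  marginal (fun c => \sum_(i | P i) F i c) = \sum_(i | P i) marginal (F i).
Proof. by rewrite /marginal exchange_big. Qed.

Lemma marginalD F G : marginal (fun c => F c + G c) = marginal F + marginal G.
Proof. by rewrite /marginal big_split. Qed.

Lemma marginalZ z F : marginal (fun c => z * F c) = z * marginal F.
Proof. by rewrite /marginal mulr_sumr. Qed.

Lemma neq12 : i1 != i2.
Proof. by apply: contraTneq lt12 => ->; rewrite ltnn. Qed.

(** Summing out a coordinate leaves the total mass of its factor: 1 for d, 0 for e_a. *)
Lemma marginal_pureE v : marginal (pure v) =
  factor (v i1) x * factor (v i2) y *
  \prod_(k | (k != i1) && (k != i2)) (v k == None)%:R.
Proof.
rewrite /marginal (sum_prod_fix2 _ _ (fun k => factor (v k))) ?neq12 //.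
by under [in LHS]eq_bigr do rewrite sum_factor.
Qed.

Lemma marginal_pure v : (forall k, k != i1 -> k != i2 -> v k = None) ->
  marginal (pure v) = factor (v i1) x * factor (v i2) y.
Proof.
move=> vN; rewrite marginal_pureE big1 ?mulr1 // => k /andP[k1 k2].
by rewrite vN.
Qed.

Lemma marginal_pure0 v k : k != i1 -> k != i2 -> v k != None ->
  marginal (pure v) = 0.
Proof.
move=> k1 k2 /negPf vk.
by rewrite marginal_pureE (bigD1 k) ?k1 //= vk mul0r mulr0.
Qed.

Lemma marginal_vec1 i a : marginal (pure (vec1 i a)) =
  (i == i1)%:R * (factor (Some a) x * factor None y) +
  (i == i2)%:R * (factor None x * factor (Some a) y).
Proof.
have [->|ne1] := eqVneq i i1.
  rewrite (negPf neq12) mul0r mul1r addr0 marginal_pure => [|k /negPf k1 _].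
    by rewrite /vec1 eqxx (eq_sym i2 i1) (negPf neq12).
  by rewrite /vec1 k1.
have [->|ne2] := eqVneq i i2.
  rewrite mul0r mul1r add0r marginal_pure => [|k _ /negPf k2].
    by rewrite /vec1 eqxx (negPf neq12).
  by rewrite /vec1 k2.
by rewrite !mul0r addr0 (marginal_pure0 ne1 ne2) // /vec1 eqxx.
Qed.

Lemma marginal_vec2 (i j : 'I_q) a b : (i < j)%N ->
  marginal (pure (vec2 i j a b)) =
  ((i == i1) && (j == i2))%:R * (factor (Some a) x * factor (Some b) y).
Proof.
move=> ltij.
have [/andP[/eqP-> /eqP->]|neij] := boolP ((i == i1) && (j == i2)).
  rewrite mul1r marginal_pure => [|k /negPf k1 /negPf k2].
    by rewrite /vec2 !eqxx (eq_sym i2 i1) (negPf neq12).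
  by rewrite /vec2 k1 k2.
rewrite mul0r.
have [/andP[i_1 i_2]|] := boolP ((i != i1) && (i != i2)).
  by rewrite (marginal_pure0 i_1 i_2) // /vec2 eqxx.
have [/andP[j_1 j_2] _|] := boolP ((j != i1) && (j != i2)).
  by rewrite (marginal_pure0 j_1 j_2) // /vec2 eqxx; case: ifP.
(* Now [i] and [j] both lie in {[i1], [i2]}, so either [i = j] or the pair is ([i2], [i1]); both
   contradict the orderings. *)
move: neij ltij lt12; rewrite !negb_and !negbK.
do ![case: eqP => [->|_] //=]; rewrite ?ltnn // => _ lt21 lt12'.
by move: (ltn_trans lt21 lt12'); rewrite ltnn.
Qed.

End Marginal.

Definition crystal (M : 'M[int]_m.+1) c : int :=
  \sum_(p : 'I_q * 'I_q | (p.1 < p.2)%N) \sum_a \sum_b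
     M a b * pure (vec2 p.1 p.2 a b) c
  + \sum_i \sum_a (\sum_b M a b) * pure (vec1 i a) c
  + (\sum_a \sum_b M a b) * pure (fun=> None) c.

Lemma crystalP (M : 'M[int]_m.+1) :
  (forall a, \sum_b M a b = \sum_b M b a) -> is_crystal M (crystal M).
Proof.
move=> hM i1 i2 lt12 x y.
rewrite -/(marginal i1 i2 x y (crystal M)) /crystal !marginalD marginalZ.
rewrite marginal_pure // !marginal_sum.
(* Among the increasing pairs, only ([i1], [i2]) has a nonzero contribution. *)
rewrite (bigD1 (i1, i2)) //= [X in _ + X + _ + _]big1 ?addr0; last first.
  move=> [i j] /andP[/= ltij ne]; rewrite marginal_sum big1 // => a _.
  rewrite marginal_sum big1 // => b _; rewrite marginalZ marginal_vec2 //.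
  by move: ne; rewrite xpair_eqE => /negPf->; rewrite mul0r mulr0.
have sum_eq (i0 : 'I_q) (z : int) : \sum_i (i == i0)%:R * z = z.
  by rewrite (bigD1 i0) //= eqxx mul1r big1 ?addr0 // => i /negPf->;
    rewrite mul0r.
have -> : \sum_i marginal i1 i2 x y
      (fun c => \sum_a (\sum_b M a b) * pure (vec1 i a) c) =
    \sum_a \sum_b M a b * (factor (Some a) x * factor None y) +
    \sum_a \sum_b M a b * (factor None x * factor (Some b) y).
  under eq_bigr do rewrite marginal_sum.
  (* The part in d (x) e_b calls for column sums of [M]; after swapping its sums, [hM] turns them
     into the row sums used in [crystal]. *)
  rewrite exchange_big [X in _ = _ + X]exchange_big -big_split /=.
  apply: eq_bigr => a _; rewrite -!mulr_suml -hM -mulrDr.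
  under eq_bigr do rewrite marginalZ marginal_vec1 //.
  by rewrite -mulr_sumr big_split /= !sum_eq.
rewrite marginal_sum mulr_suml -!big_split /=.
(* The four parts recombine into (e_a + d) (x) (e_b + d), the point mass at [(a, b)]. *)
transitivity (\sum_a \sum_b M a b * ((x == a)%:R * (y == b)%:R)).
  apply: eq_bigr => a _; rewrite marginal_sum mulr_suml -!big_split /=.
  apply: eq_bigr => b _; rewrite marginalZ marginal_vec2 // !eqxx /=; ring.
rewrite (bigD1 x) //= [X in _ + X]big1 ?addr0 => [|a /negPf ax]; last first.
  by rewrite big1 // => b _; rewrite eq_sym ax mul0r mulr0.
rewrite (bigD1 y) //= !eqxx !mulr1 big1 ?addr0 // => b /negPf yb.
by rewrite eq_sym yb !mulr0.
Qed.

End Crystal.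

Theorem theorem2p14 (q n : nat) (M : 'M[int]_n)
    (hM : M *m (const_mx 1 : 'cV[int]_n) = M^T *m (const_mx 1 : 'cV[int]_n)) :
  exists C : {ffun 'I_q -> 'I_n} -> int, is_crystal M C.
Proof.
(* The base point needs [n > 0]; for [n = 0] there are no [a], [b] to check. *)
case: n M hM => [|m] M hM; first by exists (fun=> 0) => i1 i2 _ [].
exists (crystal M); apply: crystalP => a.
move/matrixP: hM => /(_ a 0); rewrite !mxE.
under eq_bigr do rewrite mxE mulr1.
by under [RHS]eq_bigr do rewrite !mxE mulr1.
Qed.
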